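(* Let $\xi$ be a Killing vector field of constant length on some connected Riemannian manifold $M$ such that $d\xi$ is a twistor $2$-form. Then $\xi$ is either parallel or defines a Sasakian structure on $M$.
   Context: Vectors and $1$-forms are identified via the metric, so $d\xi$ is the exterior derivative of the $1$-form dual to $\xi$. A $p$-form $u$ on a Riemannian manifold $M^n$ is a twistor form if $\nabla_Xu=\frac1{p+1}X\lrcorner du-\frac1{n-p+1}X\wedge\delta u$ for all vector fields $X$, where $d$ is the exterior derivative and $\delta$ the codifferential. A Sasakian structure on $M$ is a Killing vector field $\xi$ of constant length such that, for some constant $k>0$, $\nabla^2_{X,Y}\xi=k(\langle\xi,Y\rangle X-\langle X,Y\rangle\xi)$ for all $X,Y\in TM$. *)

(* Defs.v *)
From mathcomp Require Import all_boot all_order all_algebra.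
From mathcomp Require Import all_classical all_reals all_analysis.

Set Implicit Arguments.
Unset Strict Implicit.
Unset Printing Implicit Defensive.

Import Order.TTheory GRing.Theory Num.Theory.
Import numFieldNormedType.Exports.

Local Open Scope classical_set_scope.
Local Open Scope ring_scope.

(* C^oo on an open set D: every iterated directional derivative of f exists
   and is (Frechet) differentiable at every point of D. *)
Definition smooth_on (R : realType) (V W : normedModType R) (D : set V)
    (f : V -> W) : Prop :=
  forall (s : seq V) (x : V), D x ->
    differentiable (foldr (fun v h => fun y : V => 'D_v h y) f s) x.

(* Smooth n-manifold given by an atlas. [coord i] and [param i] are mutually
   inverse homeomorphisms between the open sets [dom i] and [coord i @` dom i];
   their values elsewhere are irrelevant. The atlas need not be maximal. *)
Record manifold (R : realType) (n : nat) : Type := Manifold {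
  mspace :> topologicalType;
  chart : Type;
  dom : chart -> set mspace;
  coord : chart -> mspace -> 'rV[R]_n;
  param : chart -> 'rV[R]_n -> mspace;
  mspace_hausdorff : hausdorff_space mspace;
  mspace_second_countable : @second_countable mspace;
  dom_cover : forall m : mspace, exists i, dom i m;
  dom_open : forall i, open (dom i);
  cod_open : forall i, open (coord i @` dom i);
  coordK : forall i (m : mspace), dom i m -> param i (coord i m) = m;
  coord_continuous : forall i, {within dom i, continuous (coord i)};
  param_continuous : forall i,
    {within coord i @` dom i, continuous (param i)};
  transition_smooth : forall i j,
    smooth_on (coord i @` (dom i `&` dom j)) (coord j \o param i)
}.

Section Fields.
Variables (R : realType) (n : nat) (M : manifold R n).

Definition cod (i : chart M) : set 'rV[R]_n := coord i @` dom i.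

Definition overlap (i j : chart M) : set 'rV[R]_n :=
  coord i @` (dom i `&` dom j).

Definition transition (i j : chart M) : 'rV[R]_n -> 'rV[R]_n :=
  coord j \o param i.

(* Smooth vector field: its component vector in each chart, as a function of
   the coordinates. *)
Record vector_field : Type := VectorField {
  vcomp :> chart M -> 'rV[R]_n -> 'rV[R]_n;
  vcomp_smooth : forall i, smooth_on (cod i) (vcomp i);
  vcomp_transition : forall i j x, overlap i j x ->
    vcomp j (transition i j x) = 'D_(vcomp i x) (transition i j) x
}.

Definition inner (G : 'rV[R]_n -> 'M[R]_n) (x u v : 'rV[R]_n) : R :=
  (u *m G x *m v^T) ord0 ord0.

(* Riemannian metric: its Gram matrix in each chart. *)
Record riemannian_metric : Type := RiemannianMetric {
  gram :> chart M -> 'rV[R]_n -> 'M[R]_n;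
  gram_smooth : forall i, smooth_on (cod i) (gram i);
  gram_sym : forall i x, cod i x -> (gram i x)^T = gram i x;
  gram_pos : forall i x u, cod i x -> u != 0 -> 0 < inner (gram i) x u u;
  gram_transition : forall i j x u v, overlap i j x ->
    inner (gram i) x u v =
    inner (gram j) (transition i j x)
      ('D_u (transition i j) x) ('D_v (transition i j) x)
}.

End Fields.

(* Tensor calculus in one chart, G being the Gram matrix of the metric. A
   tangent vector stands for the field with constant components extending it;
   such fields commute, so no Lie bracket of them appears below. *)
Section LocalGeometry.
Variables (R : realType) (n : nat) (G : 'rV[R]_n -> 'M[R]_n).

Local Notation E := 'rV[R]_n.

Definition evec (a : 'I_n) : E := delta_mx ord0 a.

(* nabla_u v for u, v constant, from Koszul's formula
   2 <nabla_u v, w> = u <v, w> + v <u, w> - w <u, v>. *)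
Definition christoffel (x u v : E) : E :=
  (\row_c (2^-1 * ('D_u (fun y => inner G y v (evec c)) x
                   + 'D_v (fun y => inner G y u (evec c)) x
                   - 'D_(evec c) (fun y => inner G y u v) x)))
  *m invmx (G x).

Definition nabla (X Y : E -> E) : E -> E :=
  fun x => 'D_(X x) Y x + christoffel x (X x) (Y x).

Definition nabla2 (X Y Z : E -> E) : E -> E :=
  fun x => nabla X (nabla Y Z) x - nabla (nabla X Y) Z x.

(* (L_Z g)(u, v) = Z <u, v> - <[Z, u], v> - <u, [Z, v]>, with [Z, u] = - D_u Z
   since u is constant. *)
Definition lie_metric (Z : E -> E) (x u v : E) : R :=
  'D_(Z x) (fun y => inner G y u v) x
  + inner G x ('D_u Z x) v + inner G x u ('D_v Z x).

(* Local expressions of p-forms: at each point, an alternating multilinear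
   function of p tangent vectors. *)
Definition lform (p : nat) : Type := E -> ('I_p -> E) -> R.

Definition vcons (p : nat) (X : E) (Y : 'I_p -> E) : 'I_p.+1 -> E :=
  fun k => if unlift ord0 k is Some j then Y j else X.

Definition flat (Z : E -> E) : lform 1 :=
  fun x Y => inner G x (Z x) (Y ord0).

(* Normalized without the factor 1/(p+1), so that du is the sum of
   e_i /\ nabla_{e_i} u over a local orthonormal frame. *)
Definition ext_d (p : nat) (u : lform p) : lform p.+1 :=
  fun x Y => \sum_(k < p.+1) (-1) ^+ k *
    'D_(Y k) (fun y => u y (fun j => Y (lift k j))) x.

Definition interior (p : nat) (X : E) (u : lform p.+1) : lform p :=
  fun x Y => u x (vcons X Y).

(* X is identified with the 1-form <X, _>. *)
Definition wedge (p : nat) (X : E) (u : lform p) : lform p.+1 :=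
  fun x Y => \sum_(k < p.+1) (-1) ^+ k *
    (inner G x X (Y k) * u x (fun j => Y (lift k j))).

Definition nabla_form (p : nat) (X : E) (u : lform p) : lform p :=
  fun x Y => 'D_X (fun y => u y Y) x
    - \sum_(k < p) u x [eta Y with k |-> christoffel x X (Y k)].

(* - sum_i e_i _| nabla_{e_i} u over an orthonormal basis, written in the
   coordinate basis with the inverse Gram matrix. *)
Definition codiff (p : nat) (u : lform p.+1) : lform p :=
  fun x Y => - \sum_(a < n) \sum_(b < n) invmx (G x) a b *
    interior (evec b) (nabla_form (evec a) u) x Y.

End LocalGeometry.

Section Global.
Variables (R : realType) (n : nat) (M : manifold R n).
Variable g : riemannian_metric M.

Definition killing (xi : vector_field M) : Prop :=
  forall i x, cod i x -> forall u v, lie_metric (g i) (xi i) x u v = 0.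

Definition constant_length (xi : vector_field M) : Prop :=
  exists c : R, forall i x, cod i x ->
    Num.sqrt (inner (g i) x (xi i x) (xi i x)) = c.

Definition parallel (xi : vector_field M) : Prop :=
  forall i x, cod i x -> forall u, nabla (g i) (cst u) (xi i) x = 0.

(* Local expressions of the 1-form dual to xi, and of its differential. *)
Definition dual_form (xi : vector_field M) (i : chart M) : lform R n 1 :=
  flat (g i) (xi i).

Definition d_dual (xi : vector_field M) (i : chart M) : lform R n 2 :=
  ext_d (dual_form xi i).

(* Intended for forms, i.e. families u that are smooth, alternating multilinear
   and compatible with the transition maps; d_dual always is such a family.
   A form of degree q = p.+1 given by its local expressions, so that the
   constants 1/(q+1) and 1/(n-q+1) read 1/(p+2) and 1/(n-p). When n = p they
   multiply a form of degree n+1, which vanishes. *)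
Definition twistor_form (p : nat) (u : chart M -> lform R n p.+1) : Prop :=
  forall i x, cod i x -> forall (X : 'rV[R]_n) (Y : 'I_p.+1 -> 'rV[R]_n),
    nabla_form (g i) X (u i) x Y =
    p.+2%:R^-1 * interior X (ext_d (u i)) x Y
    - (n%:R - p%:R)^-1 * wedge (g i) X (codiff (g i) (u i)) x Y.

Definition sasakian (xi : vector_field M) : Prop :=
  [/\ killing xi, constant_length xi &
    exists2 k : R, 0 < k & forall i x, cod i x -> forall u v,
      nabla2 (g i) (cst u) (cst v) (xi i) x =
      k *: (inner (g i) x (xi i x) v *: u - inner (g i) x u v *: xi i x)].

End Global.

(* Main.v *)
From HB Require Import structures.
Require Import Defs.
From mathcomp Require Import all_boot all_order all_algebra.
From mathcomp Require Import all_classical all_reals all_analysis.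
From mathcomp Require Import ring lra.

(* Put A u = nabla_u xi, which is skew because xi is Killing, and
   L = <xi, xi>. Since d xi is closed, the twistor equation leaves only the
   codifferential term, so that
     nabla^2_{u,v} xi = <alpha, v> u - <u, v> alpha
   for some vector alpha at each point. Differentiating <A v, xi> = 0 gives
   <nabla^2_{u,v} xi, xi> = - <A u, A v>, whose symmetry in u and v forces
   alpha = k xi and <A u, A v> = k (L <u, v> - <u, xi> <v, xi>).
   Differentiating the last identity at u = v = w, for a w which is not a
   multiple of xi, shows that k is locally constant. It does not depend on the
   chart because nabla xi is half of d xi, which is natural; hence k is
   constant on the connected manifold M. If k <= 0, then A = 0. *)

Set Implicit Arguments.
Unset Strict Implicit.
Unset Printing Implicit Defensive.

Import Order.TTheory GRing.Theory Num.Theory.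
Import numFieldNormedType.Exports.

Local Open Scope classical_set_scope.
Local Open Scope ring_scope.

(** * Differential calculus *)

Section Calculus.
Variables (R : realType) (V : normedModType R).
Implicit Types (U : set V) (x u v : V).

(** The differential of [f] gives a first-order expansion of [g] at [x], and [diff_unique]
    identifies it with the differential of [g]. *)
Lemma near_eq_differentiable (W : normedModType R) (f g : V -> W) x :
  {near x, f =1 g} -> differentiable f x -> differentiable g x.
Proof.
move=> fg df; have fgx : f x = g x := nbhs_singleton fg.
have gE : g \o shift x = cst (g x) + 'd f x +o_ 0 id.
  apply/(eqaddoP _ _ _ _).2 => e e0.
  have := (eqaddoP _ _ _ _).1 (diff_locally df) _ e0.
  have : \forall y \near 0, f (y + x) = g (y + x).
    have : \near x, f x = g x by [].
    rewrite (near_shift 0 x) subr0.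
    by apply: filterS => y.
  apply: filterS2 => y fgy.
  by rewrite !(fctE, opprD) /= fgy fgx.
have dc := diff_continuous df.
have dE := diff_unique dc gE.
by apply/diff_locallyP; rewrite dE; split.
Qed.

Lemma diff_remainder (W : normedModType R) (f : V -> W) x :
  differentiable f x -> forall e : R, 0 < e ->
  \forall h \near (0 : V), `|f (h + x) - f x - 'd f x h| <= e * `|h|.
Proof.
move=> /diff_locally => df e e0.
have := (eqaddoP _ _ _ _).1 df e e0.
by apply: filterS => h; rewrite !fctE /= opprD addrA.
Qed.

Lemma is_derive_line (W : normedModType R) (f : V -> W) u p (s : R) :
  derivable f (s *: u + p) u ->
  is_derive s (1 : R) (fun t : R => f (t *: u + p)) ('D_u f (s *: u + p)).
Proof.
have E : (fun h : R => h^-1 *: (f (h *: u + (s *: u + p)) - f (s *: u + p))) =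
   (fun h : R => h^-1 *: (f ((h%:A + s) *: u + p) - f (s *: u + p))).
  by apply/funext => h; rewrite addrA -scalerDl /GRing.scale /= mulr1.
move=> df; split; first by move: df; rewrite /derivable E.
by rewrite /derive E.
Qed.

Lemma mvt_line (f : V -> R) u p (t : R) : 0 < t ->
  (forall s, 0 <= s <= t -> derivable f (s *: u + p) u) ->
  exists2 s, 0 < s < t & f (t *: u + p) - f p = t * 'D_u f (s *: u + p).
Proof.
move=> t0 df.
have [||s] := @MVT R (fun s => f (s *: u + p))
  (fun s => 'D_u f (s *: u + p)) 0 t t0.
- move=> s; rewrite in_itv /= => /andP[s0 st].
  by apply: is_derive_line; apply: df; rewrite !ltW.
- apply: derivable_within_continuous => s; rewrite in_itv /= => st.
  by have [] := is_derive_line (df _ st).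
- rewrite in_itv /= => st; rewrite scale0r add0r subr0 => ->; exists s => //.
  by rewrite mulrC.
Qed.

(** For F(y) = f(y + t v) - f(y), the mean value theorem along u yields t times a difference of two
    values of D_u f near x. The first-order expansion of D_u f at x turns it into t^2 D_v D_u f(x),
    up to the error. *)
Lemma second_difference_estimate (f : V -> R) x u v :
  (\near x, differentiable f x) -> differentiable ('D_u f) x ->
  forall e : R, 0 < e -> \forall t \near (0 : R)^'+,
  `|(f (t *: u + (t *: v + x)) - f (t *: v + x) - f (t *: u + x) + f x)
    - t ^+ 2 * 'D_v ('D_u f) x| <= e * t ^+ 2.
Proof.
move=> df dDf e e0.
(* Remainders will be taken at the increments s u + t v and s u with 0 <= s <= t, whose norms add up
   to at most t (2 |u| + |v|); the extra 1 makes [C] positive. *)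
set C := 2 * `|u| + `|v| + 1.
have C0 : 0 < C by rewrite ltr_wpDl // addr_ge0 // mulr_ge0.
have /nbhs_ballP[r /= r0 rP] := diff_remainder dDf (divr_gt0 e0 C0).
have := df; rewrite (near_shift 0 x) subr0 => /nbhs_ballP[r' /= r'0 r'P].
have rr : 0 < Num.min r r' by rewrite lt_min r0.
near=> t.
have t0 : 0 < t by near: t; exact: nbhs_right_gt.
have tC : t * C < Num.min r r'.
  rewrite -ltr_pdivlMr //; near: t; apply: nbhs_right_lt; exact: divr_gt0.
have small (s : R) (w : V) : 0 <= s <= t -> w = 0 \/ w = v ->
    `|s *: u + t *: w| <= t * (`|u| + `|w|) /\ t * (`|u| + `|w|) < Num.min r r'.
  move=> /andP[s0 st] w0; split.
    rewrite (le_trans (ler_normD _ _)) // !normrZ !ger0_norm ?(ltW t0) //.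
    by rewrite mulrDr lerD2r ler_wpM2r.
  apply: le_lt_trans tC; rewrite ler_pM2l // /C.
  have [u0 v0] : 0 <= `|u| /\ 0 <= `|v| by [].
  by case: w0 => ->; rewrite ?normr0; lra.
have smallb s w : 0 <= s <= t -> w = 0 \/ w = v ->
    ball (0 : V) r (s *: u + t *: w) /\ ball (0 : V) r' (s *: u + t *: w).
  move=> st w0; have [h1 h2] := small _ _ st w0.
  have := le_lt_trans h1 h2.
  by rewrite lt_min -!ball_normE /= !sub0r !normrN => /andP[].
pose F y := f (y + (t *: v)) - f y.
have dF s : 0 <= s <= t ->
    differentiable f (s *: u + x) /\ differentiable f (s *: u + x + t *: v).
  move=> st; split.
    have [_] := smallb s 0 st (or_introl erefl).
    by rewrite scaler0 addr0 => /r'P.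
  have [_ /r'P] := smallb s v st (or_intror erefl).
  by rewrite /= addrAC.
have sh p w : derivable f (p + w) u -> derivable (f \o shift w) p u
   /\ 'D_u (f \o shift w) p = 'D_u f (p + w).
  rewrite /derivable /derive /=.
  by under eq_fun do rewrite addrA.
have [|s s0t] := @mvt_line F u x t t0.
  move=> s /dF[d1 d2]; apply: derivableB; last exact: diff_derivable.
  by have [] := sh _ _ (diff_derivable d2).
have /dF[d1 d2] : 0 <= s <= t by case/andP: s0t => ? ?; rewrite !ltW.
have [d3 d3E] := sh _ _ (diff_derivable (v := u) d2).
have -> : 'D_u F (s *: u + x) =
    'D_u f (s *: u + t *: v + x) - 'D_u f (s *: u + x).
  rewrite /F -[LHS]/('D_u ((f \o shift (t *: v)) - f) _).
  rewrite deriveB //; last exact: diff_derivable.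
  by rewrite d3E addrAC.
move=> FE.
have -> : f (t *: u + (t *: v + x)) - f (t *: v + x) - f (t *: u + x)
    + f x = F (t *: u + x) - F x.
  by rewrite /F -(addrA (t *: u) x) (addrC x (t *: v)); ring.
rewrite FE.
have st' : 0 <= s <= t by case/andP: s0t => ? ?; rewrite !ltW.
have [/rP h1 _] := smallb _ _ st' (or_intror erefl).
have [/rP h2 _] := smallb _ _ st' (or_introl erefl).
have [n1 _] := small _ _ st' (or_intror erefl).
have [n2 _] := small _ _ st' (or_introl erefl).
rewrite (deriveE v dDf).
move: h1 h2 n1 n2; rewrite /= scaler0 addr0 normr0 addr0 linearD.
rewrite [X in `|_ - (X + _)|]linearZ [X in `|_ - (_ + X)|]linearZ.
rewrite [X in `|_ - X| <= _ * `|s *: u| -> _]linearZ /=.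
set a := 'd _ x u; set b := 'd _ x v.
rewrite -[s *: a]/(s * a) -[t *: b]/(t * b).
set P1 := 'D_u f (_ + _ + _); set P2 := 'D_u f (_ + _).
set P0 := 'D_u f x => h1 h2 n1 n2.
(* The terms in s cancel, which leaves the difference of the two remainders of D_u f. *)
have -> : t * (P1 - P2) - t ^+ 2 * b =
    t * ((P1 - P0 - (s * a + t * b)) - (P2 - P0 - s * a)) by ring.
rewrite normrM gtr0_norm // expr2 mulrCA ler_pM2l //.
apply: le_trans (ler_normB _ _) _.
apply: le_trans (lerD h1 h2) _.
rewrite -mulrDr -mulrA ler_pM2l // ler_pdivrMl // mulrC.
apply: le_trans (lerD n1 n2) _.
rewrite -mulrDr ler_pM2l // /C; lra.
Unshelve. all: by end_near. Qed.

(** Both sides are limits of the same second difference divided by t^2, which is symmetric in u and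
    v. *)
Lemma schwarz (f : V -> R) x u v :
  (\near x, differentiable f x) -> differentiable ('D_u f) x ->
  differentiable ('D_v f) x -> 'D_v ('D_u f) x = 'D_u ('D_v f) x.
Proof.
move=> df du dv; apply/eqP; rewrite -subr_eq0 -normr_le0.
apply/ler_addgt0Pl => e e0.
rewrite addr0.
have e2 : 0 < e / 2 by rewrite divr_gt0.
have h1 := second_difference_estimate v df du e2.
have h2 := second_difference_estimate u df dv e2.
suff /filter_ex[t] : \forall t \near (0 : R)^'+,
  `|'D_v ('D_u f) x - 'D_u ('D_v f) x| <= e by [].
have h0 : \forall t \near (0 : R)^'+, 0 < t := nbhs_right_gt 0.
apply: filterS3 h0 h1 h2 => t t0.
(* Brings the second difference of one estimate to the form it has in the other, with u and v
   exchanged. *)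
rewrite (addrCA (t *: v)) (addrAC _ (- f (t *: v + x)) (- f (t *: u + x))).
move: (_ + f x) ('D_v ('D_u f) x) ('D_u ('D_v f) x) => D p q h' h.
rewrite -(ler_pM2l (exprn_gt0 2 t0)) -{1}(gtr0_norm (exprn_gt0 2 t0)) -normrM.
have -> : t ^+ 2 * (p - q) = (D - t ^+ 2 * q) - (D - t ^+ 2 * p) by ring.
apply: le_trans (ler_normB _ _) _.
apply: le_trans (lerD h h') _.
by rewrite -mulrDl -splitr mulrC.
Qed.

(** A ball around x inside [U] contains the segment from x to any of its points y, and the mean
    value theorem applies along it. *)
Lemma locally_constant U (f : V -> R) x : open U -> U x ->
  (forall y u, U y -> derivable f y u) ->
  (forall y u, U y -> 'D_u f y = 0) -> \forall y \near x, f y = f x.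
Proof.
move=> oU Ux df df0.
have /nbhs_ballP[r /= r0 rU] : nbhs x U by exact: open_nbhs_nbhs.
apply/nbhs_ballP; exists r => //= y xy.
have inU s : 0 <= s <= 1 -> U (s *: (y - x) + x).
  move=> /andP[s0 s1]; apply: rU; move: xy; rewrite -!ball_normE /= => xy.
  rewrite opprD addrCA subrr addr0 normrN normrZ distrC ger0_norm //.
  by apply: le_lt_trans xy; rewrite ler_piMl.
have [s s0|s /andP[s0 s1]] := @mvt_line f (y - x) x 1 ltr01.
  exact/df/inU.
rewrite scale1r subrK => fE; apply/eqP; rewrite -subr_eq0 fE.
by rewrite df0 ?mulr0 //; apply: inU; rewrite !ltW.
Qed.

Lemma derive_comp (W : normedModType R) (f : V -> W) (h : W -> R) x u :
  differentiable f x -> differentiable h (f x) ->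
  'D_u (h \o f) x = 'D_('D_u f x) h (f x).
Proof.
move=> df dh; rewrite !deriveE //; last exact: differentiable_comp.
by rewrite diff_comp.
Qed.

(** * Derivatives of finite sums and of matrix-valued functions *)

Lemma derivable_bigsum (I : Type) (r : seq I) (P : pred I) (h : I -> V -> R) x v :
  (forall i, derivable (h i) x v) ->
  derivable (fun y => \sum_(i <- r | P i) h i y) x v.
Proof.
move=> dh; elim: r => [|i r IH].
  by under eq_fun do rewrite big_nil; exact: derivable_cst.
under eq_fun do rewrite big_cons.
by case: (P i); [exact: (derivableD (dh i) IH)|exact: IH].
Qed.

Lemma derive_bigsum (I : Type) (r : seq I) (P : pred I) (h : I -> V -> R) x v :
  (forall i, derivable (h i) x v) ->
  'D_v (fun y => \sum_(i <- r | P i) h i y) x = \sum_(i <- r | P i) 'D_v (h i) x.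
Proof.
move=> dh; elim: r => [|i r IH].
  by under eq_fun do rewrite big_nil; rewrite derive_cst big_nil.
under eq_fun do rewrite big_cons.
rewrite big_cons; case: (P i) => //.
by rewrite -IH deriveD //; exact: derivable_bigsum.
Qed.

Lemma derivable_bigprod (I : Type) (r : seq I) (P : pred I) (h : I -> V -> R) x v :
  (forall i, derivable (h i) x v) ->
  derivable (fun y => \prod_(i <- r | P i) h i y) x v.
Proof.
move=> dh; elim: r => [|i r IH].
  by under eq_fun do rewrite big_nil; exact: derivable_cst.
under eq_fun do rewrite big_cons.
by case: (P i); [exact: (derivableM (dh i) IH)|exact: IH].
Qed.

Lemma derivable_entry m n (M : V -> 'M[R]_(m, n)) i j x v :
  derivable M x v -> derivable (fun y => M y i j) x v.
Proof. by move/derivable_mxP. Qed.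

Lemma derive_entry m n (M : V -> 'M[R]_(m, n)) i j x v :
  derivable M x v -> 'D_v (fun y => M y i j) x = 'D_v M x i j.
Proof. by move=> /derive_mx ->; rewrite mxE. Qed.

Lemma derivable_mulmx m n p (M : V -> 'M[R]_(m, n)) (N : V -> 'M[R]_(n, p)) x v :
  derivable M x v -> derivable N x v -> derivable (fun y => M y *m N y) x v.
Proof.
move=> dM dN; apply/derivable_mxP => i j.
under eq_fun do rewrite mxE.
by apply: derivable_bigsum => k; apply: derivableM; exact: derivable_entry.
Qed.

Lemma derive_mulmx m n p (M : V -> 'M[R]_(m, n)) (N : V -> 'M[R]_(n, p)) x v :
  derivable M x v -> derivable N x v ->
  'D_v (fun y => M y *m N y) x = 'D_v M x *m N x + M x *m 'D_v N x.
Proof.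
move=> dM dN; apply/matrixP => i j.
rewrite -derive_entry; last exact: derivable_mulmx.
under eq_fun do rewrite mxE.
rewrite derive_bigsum; last first.
  by move=> k; apply: derivableM; exact: derivable_entry.
rewrite !mxE -big_split /=; apply: eq_bigr => k _.
rewrite deriveM; [|exact: derivable_entry..].
rewrite !derive_entry // addrC; congr (_ + _). exact: mulrC.
Qed.

Lemma derivable_trmx m n (M : V -> 'M[R]_(m, n)) x v :
  derivable M x v -> derivable (fun y => (M y)^T) x v.
Proof.
move=> dM; apply/derivable_mxP => i j.
by under eq_fun do rewrite mxE; exact: derivable_entry.
Qed.

Lemma derive_trmx m n (M : V -> 'M[R]_(m, n)) x v :
  derivable M x v -> 'D_v (fun y => (M y)^T) x = ('D_v M x)^T.
Proof.
move=> dM; apply/matrixP => i j.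
rewrite -derive_entry; last exact: derivable_trmx.
by under eq_fun do rewrite mxE; rewrite derive_entry // mxE.
Qed.

Lemma derivable_det n (M : V -> 'M[R]_n) x v :
  derivable M x v -> derivable (fun y => \det (M y)) x v.
Proof.
move=> dM; apply: derivable_bigsum => s.
apply: derivableM; first exact: derivable_cst.
by apply: derivable_bigprod => i; exact: derivable_entry.
Qed.

Lemma derivable_invmx n (M : V -> 'M[R]_n) x v :
  (\forall y \near x, M y \in unitmx) ->
  derivable M x v -> derivable (fun y => invmx (M y)) x v.
Proof.
(* Cramer's formula holds on a whole neighbourhood; at a singular matrix [invmx] would be the
   identity map instead. *)
move=> uM dM; apply: (@near_eq_derivable _ _ _
  (fun y => (\det (M y))^-1 *: \adj (M y))).
  by apply: filterS uM => y uMy; rewrite /invmx uMy.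
apply/derivable_mxP => i j.
under eq_fun do rewrite !mxE.
apply: derivableM.
  apply: derivableV; last exact: derivable_det.
  by have := nbhs_singleton uM; rewrite unitmxE unitfE.
apply: derivableM; first exact: derivable_cst.
apply: derivable_det; apply/derivable_mxP => k l.
by under eq_fun do rewrite !mxE; exact: derivable_entry.
Qed.

(** Regularity sufficient for [schwarz] on an open set. It follows from [smooth_on] and passes
    easily through sums and products. *)
Definition C2_on U (f : V -> R) : Prop := forall x, U x ->
  differentiable f x /\ forall u, differentiable ('D_u f) x.

Lemma C2_on_mul U (f h : V -> R) : open U ->
  C2_on U f -> C2_on U h -> C2_on U (fun y => f y * h y).
Proof.
move=> oU Cf Ch x Ux; have [df ddf] := Cf x Ux; have [dh ddh] := Ch x Ux.
split=> [|u]; first exact: differentiableM.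
apply: (@near_eq_differentiable _
  (fun y => f y * 'D_u h y + h y * 'D_u f y)).
  near=> y; have Uy : U y by near: y; exact: open_nbhs_nbhs.
  have [dfy _] := Cf y Uy; have [dhy _] := Ch y Uy.
  by rewrite [RHS]deriveM //; exact: diff_derivable.
by apply: differentiableD; apply: differentiableM.
Unshelve. all: by end_near. Qed.

Lemma C2_on_cst U (c : R) : C2_on U (fun=> c).
Proof.
move=> x _; split=> [|u]; first exact: differentiable_cst.
rewrite (_ : 'D_u _ = cst 0); first exact: differentiable_cst.
by apply/funext => y; rewrite derive_cst.
Qed.

Lemma C2_on_add U (f h : V -> R) : open U ->
  C2_on U f -> C2_on U h -> C2_on U (fun y => f y + h y).
Proof.
move=> oU Cf Ch x Ux; have [df ddf] := Cf x Ux; have [dh ddh] := Ch x Ux.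
split=> [|u]; first exact: differentiableD.
apply: (@near_eq_differentiable _ (fun y => 'D_u f y + 'D_u h y)).
  near=> y; have Uy : U y by near: y; exact: open_nbhs_nbhs.
  have [dfy _] := Cf y Uy; have [dhy _] := Ch y Uy.
  by rewrite [RHS]deriveD //; exact: diff_derivable.
exact: differentiableD.
Unshelve. all: by end_near. Qed.

Lemma C2_on_sum U (I : Type) (r : seq I) (h : I -> V -> R) : open U ->
  (forall i, C2_on U (h i)) -> C2_on U (fun y => \sum_(i <- r) h i y).
Proof.
move=> oU Ch; elim: r => [|i r IH].
  by under eq_fun do rewrite big_nil; exact: C2_on_cst.
by under eq_fun do rewrite big_cons; exact: C2_on_add.
Qed.

Lemma differentiable_entry m n (M : V -> 'M[R]_(m, n)) i j x :
  differentiable M x -> differentiable (fun y => M y i j) x.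
Proof.
move=> dM.
apply: (@differentiable_comp _ _ _ _ M (fun A : 'M[R]_(m, n) => A i j)) => //.
exact: differentiable_coord.
Qed.

Lemma C2_on_entry m n U (M : V -> 'M[R]_(m, n)) i j : open U ->
  smooth_on U M -> C2_on U (fun y => M y i j).
Proof.
move=> oU sM x Ux.
split=> [|u]; first by apply: differentiable_entry; exact: (sM [::]).
apply: (@near_eq_differentiable _ (fun y => 'D_u M y i j)).
  near=> y; have Uy : U y by near: y; exact: open_nbhs_nbhs.
  by rewrite /= derive_entry //; apply: diff_derivable; exact: (sM [::]).
by apply: differentiable_entry; exact: (sM [:: u]).
Unshelve. all: by end_near. Qed.

Lemma C2_on_schwarz U (f : V -> R) x u v : open U -> C2_on U f -> U x ->
  'D_v ('D_u f) x = 'D_u ('D_v f) x.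
Proof.
move=> oU Cf Ux; have [_ ddf] := Cf x Ux; apply: schwarz => //.
near=> y; have Uy : U y by near: y; exact: open_nbhs_nbhs.
by have [] := Cf y Uy.
Unshelve. all: by end_near. Qed.

Lemma derivative_linear (W : normedModType R) (f : V -> W) x :
  differentiable f x -> linear (fun u => 'D_u f x).
Proof. by move=> df a u v; rewrite !deriveE // linearP. Qed.

End Calculus.

(** * Metric and Levi-Civita connection in a chart *)

(* Sealed so that rewriting with bilinearity never unfolds the derivative. *)
HB.lock Definition gram_deriv (R : realType) (n : nat)
    (G : 'rV[R]_n -> 'M[R]_n) (x u v w : 'rV[R]_n) : R :=
  inner ('D_u G) x v w.

Section InnerAlgebra.
Variables (R : realType) (n : nat).
Local Notation E := 'rV[R]_n.
Implicit Types (G : E -> 'M[R]_n) (x u v w : E).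

Lemma innerDl G x u v w : inner G x (u + v) w = inner G x u w + inner G x v w.
Proof. by rewrite /inner !mulmxDl mxE. Qed.

Lemma innerDr G x u v w : inner G x u (v + w) = inner G x u v + inner G x u w.
Proof. by rewrite /inner linearD mulmxDr mxE. Qed.

Lemma innerZl G x a u w : inner G x (a *: u) w = a * inner G x u w.
Proof. by rewrite /inner -!scalemxAl mxE. Qed.

Lemma innerZr G x a u w : inner G x u (a *: w) = a * inner G x u w.
Proof. by rewrite /inner linearZ -scalemxAr mxE. Qed.

Lemma innerNl G x u w : inner G x (- u) w = - inner G x u w.
Proof. by rewrite -scaleN1r innerZl mulN1r. Qed.

Lemma innerNr G x u w : inner G x u (- w) = - inner G x u w.
Proof. by rewrite -scaleN1r innerZr mulN1r. Qed.

Lemma innerBl G x u v w : inner G x (u - v) w = inner G x u w - inner G x v w.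
Proof. by rewrite innerDl innerNl. Qed.

Lemma innerBr G x u v w : inner G x u (v - w) = inner G x u v - inner G x u w.
Proof. by rewrite innerDr innerNr. Qed.

Lemma inner0l G x w : inner G x 0 w = 0.
Proof. by rewrite -(scale0r 0) innerZl mul0r. Qed.

Lemma inner0r G x w : inner G x w 0 = 0.
Proof. by rewrite -(scale0r 0) innerZr mul0r. Qed.

Lemma inner_suml G x (I : Type) (r : seq I) (P : pred I) (F : I -> E) w :
  inner G x (\sum_(i <- r | P i) F i) w = \sum_(i <- r | P i) inner G x (F i) w.
Proof. by rewrite /inner !mulmx_suml summxE. Qed.

Lemma derive_inner G (Y1 Y2 : E -> E) x u :
  derivable G x u -> derivable Y1 x u -> derivable Y2 x u ->
  'D_u (fun y => inner G y (Y1 y) (Y2 y)) x =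
  inner G x ('D_u Y1 x) (Y2 x) + inner G x (Y1 x) ('D_u Y2 x)
  + gram_deriv G x u (Y1 x) (Y2 x).
Proof.
move=> dG d1 d2; rewrite gram_deriv.unlock; have d1G := derivable_mulmx d1 dG.
rewrite derive_entry; last by apply: derivable_mulmx => //; exact: derivable_trmx.
rewrite derive_mulmx //; last exact: derivable_trmx.
by rewrite derive_trmx // derive_mulmx // mulmxDl [LHS]mxE
  [X in X + _]mxE addrAC.
Qed.

Lemma derive_inner_cst G x u v w : derivable G x u ->
  'D_u (fun y => inner G y v w) x = gram_deriv G x u v w.
Proof.
move=> dG; rewrite (@derive_inner G (cst v) (cst w)) //.
by rewrite !derive_cst inner0l inner0r !add0r.
Qed.

Lemma derivable_inner G (Y1 Y2 : E -> E) x u :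
  derivable G x u -> derivable Y1 x u -> derivable Y2 x u ->
  derivable (fun y => inner G y (Y1 y) (Y2 y)) x u.
Proof.
move=> dG d1 d2; apply: derivable_entry; apply: derivable_mulmx.
  exact: derivable_mulmx.
exact: derivable_trmx.
Qed.

Lemma gram_deriv0 G x v w : gram_deriv G x 0 v w = 0.
Proof. by rewrite gram_deriv.unlock /inner derive0 mulmx0 mul0mx mxE. Qed.

Lemma gram_derivP G x v w a u1 u2 : differentiable G x ->
  gram_deriv G x (a *: u1 + u2) v w =
  a * gram_deriv G x u1 v w + gram_deriv G x u2 v w.
Proof.
move=> dG; rewrite gram_deriv.unlock /inner derivative_linear // mulmxDr mulmxDl.
by rewrite -scalemxAr -scalemxAl [LHS]mxE [X in X + _]mxE.
Qed.

Lemma gram_deriv_sum G x u v w : differentiable G x ->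
  gram_deriv G x u v w = \sum_k u 0 k * gram_deriv G x (evec R k) v w.
Proof.
move=> dG; rewrite {1}(row_sum_delta u).
elim: (index_enum _) => [|k r IH]; first by rewrite !big_nil gram_deriv0.
by rewrite !big_cons gram_derivP // IH.
Qed.

Lemma gram_derivPr G x u v a w1 w2 :
  gram_deriv G x u v (a *: w1 + w2) =
  a * gram_deriv G x u v w1 + gram_deriv G x u v w2.
Proof. by rewrite gram_deriv.unlock innerDr innerZr. Qed.

Lemma gram_deriv0r G x u v : gram_deriv G x u v 0 = 0.
Proof. by rewrite gram_deriv.unlock inner0r. Qed.

End InnerAlgebra.

(* Abstracting the values of [inner] keeps [ring] from comparing them by
   unfolding. *)
Ltac generalize_inner := repeat match goal with
  | |- context [inner ?G ?x ?u ?v] => generalize (inner G x u v); intro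
  | |- context [gram_deriv ?G ?x ?u ?v ?w] =>
      generalize (gram_deriv G x u v w); intro
  end.
Ltac ring_inner := generalize_inner; ring.
Ltac lra_inner := generalize_inner; intros; lra.

(** What a [riemannian_metric] provides inside one chart, so that the local theory can do without
    the manifold. *)
Record metric_on (R : realType) (n : nat) (U : set 'rV[R]_n)
    (G : 'rV[R]_n -> 'M[R]_n) : Prop := MetricOn {
  metric_open : open U;
  metric_smooth : smooth_on U G;
  metric_sym : forall x, U x -> (G x)^T = G x;
  metric_pos : forall x u, U x -> u != 0 -> 0 < inner G x u u
}.

Section Metric.
Variables (R : realType) (n : nat) (U : set 'rV[R]_n) (G : 'rV[R]_n -> 'M[R]_n).
Hypothesis mG : metric_on U G.
Local Notation E := 'rV[R]_n.
Implicit Types (x u v w : E).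

Let oU : open U := metric_open mG.
Let sG : smooth_on U G := metric_smooth mG.
Let symG := metric_sym mG.
Let posG := metric_pos mG.

Let nearU x : U x -> \forall y \near x, U y.
Proof. by move=> Ux; exact: open_nbhs_nbhs. Qed.

Let dG x : U x -> differentiable G x.
Proof. exact: (sG [::]). Qed.

Let dvG x u : U x -> derivable G x u.
Proof. by move=> /dG; exact: diff_derivable. Qed.

Lemma inner_sym x u v : U x -> inner G x u v = inner G x v u.
Proof.
move=> Ux; rewrite /inner.
have -> : u *m G x *m v^T = (v *m G x *m u^T)^T.
  by rewrite !trmx_mul trmxK symG // mulmxA.
by rewrite mxE.
Qed.

Lemma gram_deriv_sym x u v w : U x ->
  gram_deriv G x u v w = gram_deriv G x u w v.
Proof.
move=> Ux; rewrite -!derive_inner_cst; [|exact: dvG..].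
apply: near_eq_derive; apply: filterS (nearU Ux) => y Uy; exact: inner_sym.
Qed.

Lemma inner_ge0 x u : U x -> 0 <= inner G x u u.
Proof.
move=> Ux; have [->|u0] := eqVneq u 0; first by rewrite inner0l.
by rewrite ltW // posG.
Qed.

Lemma inner_eq0 x u : U x -> inner G x u u = 0 -> u = 0.
Proof.
move=> Ux uu; apply/eqP; apply: contraTT isT => /(posG Ux).
by rewrite uu ltxx.
Qed.

Lemma inner_inj x u v : U x -> (forall w, inner G x u w = inner G x v w) -> u = v.
Proof.
move=> Ux uv; apply/eqP; rewrite -subr_eq0; apply/eqP/(inner_eq0 Ux).
by rewrite innerBl uv subrr.
Qed.

(** A row of the kernel of [G x] has length zero, hence vanishes by positivity. *)
Lemma gram_unit x : U x -> G x \in unitmx.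
Proof.
move=> Ux; rewrite -row_free_unit -kermx_eq0; apply/eqP/row_matrixP => i.
rewrite row0; apply: (inner_eq0 Ux).
by rewrite /inner -row_mul mulmx_ker row0 mul0mx mxE.
Qed.

Lemma koszul x u v w : U x ->
  inner G x (christoffel G x u v) w =
  2^-1 * (gram_deriv G x u v w + gram_deriv G x v u w - gram_deriv G x w u v).
Proof.
move=> Ux; rewrite [LHS]/inner /christoffel mulmxKV ?gram_unit // mxE.
(* [christoffel] is defined through its products with the coordinate vectors; linearity of [K]
   carries the formula over to every w. *)
pose K z :=
  2^-1 * (gram_deriv G x u v z + gram_deriv G x v u z - gram_deriv G x z u v).
have Klin a z1 z2 : K (a *: z1 + z2) = a * K z1 + K z2.
  by rewrite /K !gram_derivPr gram_derivP; [ring_inner|exact: dG].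
have K0 : K 0 = 0 by rewrite /K !gram_deriv0r gram_deriv0; ring.
have Ksum (r : seq 'I_n) : K (\sum_(c <- r) w ord0 c *: evec R c) =
    \sum_(c <- r) w ord0 c * K (evec R c).
  elim: r => [|c r IH]; first by rewrite !big_nil.
  by rewrite !big_cons Klin IH.
rewrite -[RHS]/(K w) {2}(row_sum_delta w) Ksum; apply: eq_bigr => c _.
by rewrite !mxE mulrC !derive_inner_cst //; exact: dvG.
Qed.

Lemma christoffelC x u v : U x -> christoffel G x u v = christoffel G x v u.
Proof.
move=> Ux; apply: (inner_inj Ux) => w; rewrite !koszul //.
by rewrite (gram_deriv_sym w u v Ux) [X in _ * (X - _)]addrC.
Qed.

(** In the sum of the two Koszul formulas every term but u <v, w> cancels, by symmetry of the Gram
    matrix. *)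
Lemma gram_deriv_christoffel x u v w : U x ->
  gram_deriv G x u v w =
  inner G x (christoffel G x u v) w + inner G x v (christoffel G x u w).
Proof.
move=> Ux; rewrite (inner_sym _ (christoffel _ _ _ _)) // !koszul //.
by rewrite (gram_deriv_sym _ w v Ux); generalize_inner; field.
Qed.

Lemma metric_compatible (Y1 Y2 : E -> E) x u : U x ->
  derivable Y1 x u -> derivable Y2 x u ->
  'D_u (fun y => inner G y (Y1 y) (Y2 y)) x =
  inner G x (nabla G (cst u) Y1 x) (Y2 x)
  + inner G x (Y1 x) (nabla G (cst u) Y2 x).
Proof.
move=> Ux d1 d2; rewrite derive_inner //; last exact: dvG.
by rewrite gram_deriv_christoffel // /nabla innerDl innerDr /=; ring_inner.
Qed.

Lemma derivable_christoffel (Y : E -> E) x u v : U x -> derivable Y x u ->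
  derivable (fun y => christoffel G y v (Y y)) x u.
Proof.
move=> Ux dY; have dDG w : derivable ('D_w G) x u.
  by apply: diff_derivable; exact: (sG [:: w]).
apply: derivable_mulmx; last first.
  apply: (@derivable_invmx _ _ _ G); last exact: dvG.
  by apply: filterS (nearU Ux); exact: gram_unit.
apply/derivable_mxP => i c.
(* The derivative of the metric in the moving direction [Y y] is expanded over the coordinate
   vectors, so that [G] is differentiated in fixed directions only. *)
apply: (@near_eq_derivable _ _ _ (fun y =>
  2^-1 * (gram_deriv G y v (Y y) (evec R c)
  + \sum_k Y y 0 k * gram_deriv G y (evec R k) v (evec R c)
  - gram_deriv G y (evec R c) v (Y y)))).
  apply: filterS (nearU Ux) => y Uy; rewrite mxE.
  rewrite !derive_inner_cst; [|exact: dvG..].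
  by rewrite (gram_deriv_sum (Y y)) //; exact: dG.
apply: derivableM; first exact: derivable_cst.
have dc w : derivable (cst w : E -> E) x u by exact: derivable_cst.
have dg w (Y1 Y2 : E -> E) : derivable Y1 x u -> derivable Y2 x u ->
    derivable (fun y => gram_deriv G y w (Y1 y) (Y2 y)) x u.
  by move=> d1 d2; rewrite gram_deriv.unlock; exact: derivable_inner.
apply: derivableB; last exact: (dg _ _ _ (dc v) dY).
apply: derivableD; first exact: (dg _ _ _ dY (dc _)).
apply: derivable_bigsum => k; apply: derivableM; first exact: derivable_entry.
exact: (dg _ _ _ (dc _) (dc _)).
Qed.

End Metric.

(** * Killing fields of constant length in a chart *)

Lemma ext_d_flatE (R : realType) (n : nat) (G : 'rV[R]_n -> 'M[R]_n)
    (Z : 'rV[R]_n -> 'rV[R]_n) x (Y : 'I_2 -> 'rV[R]_n) :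
  ext_d (flat G Z) x Y =
  'D_(Y ord0) (fun y => inner G y (Z y) (Y (lift ord0 ord0))) x
  - 'D_(Y (lift ord0 ord0)) (fun y => inner G y (Z y) (Y ord0)) x.
Proof.
rewrite /ext_d /flat big_ord_recl big_ord1 expr0 mul1r expr1 mulN1r.
by rewrite (_ : lift (lift ord0 ord0) ord0 = ord0) //; apply: val_inj.
Qed.

Lemma derive_quadratic (R : realType) (V : normedModType R) (a b : V -> R)
    (L : R) x u : derivable a x u -> derivable b x u ->
  'D_u (fun t => L * a t - b t * b t) x = L * 'D_u a x - 2 * b x * 'D_u b x.
Proof.
move=> da db; have dL : derivable (cst L : V -> R) x u by exact: derivable_cst.
rewrite -[LHS]/('D_u (cst L * a - b * b) x).
rewrite (deriveB (derivableM dL da) (derivableM db db)).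
rewrite (deriveM dL da) (deriveM db db) derive_cst scaler0 addr0.
by move: ('D_u a x) ('D_u b x) => p q; rewrite /GRing.scale /=; ring.
Qed.

Section Killing.
Variables (R : realType) (n : nat) (U : set 'rV[R]_n) (G : 'rV[R]_n -> 'M[R]_n).
Hypothesis mG : metric_on U G.
Variable Z : 'rV[R]_n -> 'rV[R]_n.
Hypothesis sZ : smooth_on U Z.
Hypothesis killZ : forall x u v, U x -> lie_metric G Z x u v = 0.
Local Notation E := 'rV[R]_n.
Local Notation A u := (nabla G (cst u) Z).
Implicit Types (x u v w : E).

Let oU : open U := metric_open mG.
Let sG : smooth_on U G := metric_smooth mG.

Let nearU x : U x -> \forall y \near x, U y.
Proof. by move=> Ux; exact: open_nbhs_nbhs. Qed.

Let dG x u : U x -> derivable G x u.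
Proof. by move=> Ux; apply: diff_derivable; exact: (sG [::]). Qed.

Let dZ x u : U x -> derivable Z x u.
Proof. by move=> Ux; apply: diff_derivable; exact: (sZ [::]). Qed.

Lemma nabla_cst_cst u v x : nabla G (cst u) (cst v) x = christoffel G x u v.
Proof. by rewrite /nabla derive_cst add0r. Qed.

(** [nabla] reads its first argument only at [x], so the field nabla_u v may be replaced by its
    value there. *)
Lemma nabla2E u v x : nabla2 G (cst u) (cst v) Z x =
  nabla G (cst u) (A v) x - A (christoffel G x u v) x.
Proof.
rewrite /nabla2 -(nabla_cst_cst u v x); exact: erefl.
Qed.

Lemma derivable_nabla u v x : U x -> derivable (A v) x u.
Proof.
move=> Ux; apply: derivableD; first by apply: diff_derivable; exact: (sZ [:: v]).
by apply: (derivable_christoffel mG) => //; exact: dZ.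
Qed.

(** The connection is metric and torsion-free, so (L_Z g)(u, v) = <A u, v> + <u, A v>. *)
Lemma killing_skew x u v : U x -> inner G x (A u x) v = - inner G x u (A v x).
Proof.
move=> Ux; have := killZ u v Ux; rewrite /lie_metric.
rewrite derive_inner_cst; last exact: dG.
rewrite (gram_deriv_christoffel mG) // /nabla innerDl innerDr /=.
rewrite !(christoffelC mG (Z x) _ Ux).
move=> h; apply/eqP; rewrite -addr_eq0; apply/eqP.
by rewrite -[RHS]h; ring_inner.
Qed.

Lemma inner_nablaC x u v : U x -> inner G x u (A v x) = - inner G x v (A u x).
Proof. by move=> Ux; rewrite -killing_skew // (inner_sym mG). Qed.

Lemma C2_on_inner (Y : E -> E) w :
  (forall i, C2_on U (fun y => Y y 0 i)) -> C2_on U (fun y => inner G y (Y y) w).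
Proof.
move=> CY; under eq_fun => y.
  rewrite /inner mxE; under eq_bigr do rewrite mxE; over.
apply: C2_on_sum => // j; apply: C2_on_mul => //; last exact: C2_on_cst.
apply: C2_on_sum => // i.
by apply: C2_on_mul => //; exact: C2_on_entry.
Qed.

Lemma C2_on_flat w : C2_on U (fun y => inner G y (Z y) w).
Proof. by apply: C2_on_inner => i; exact: C2_on_entry. Qed.

(** The Christoffel terms cancel by symmetry, leaving <A Y0, Y1> - <A Y1, Y0>, whose two terms agree
    by skewness. *)
Lemma ext_d_dual x (Y : 'I_2 -> E) Y0 Y1 : U x ->
  Y ord0 = Y0 -> Y (lift ord0 ord0) = Y1 ->
  ext_d (flat G Z) x Y = 2 * inner G x (A Y0 x) Y1.
Proof.
move=> Ux YE0 YE1; have mc u v : 'D_u (fun y => inner G y (Z y) v) x =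
    inner G x (A u x) v + inner G x (Z x) (christoffel G x u v).
  rewrite (metric_compatible mG (Y2 := cst v)) //; last exact: dZ.
  by rewrite nabla_cst_cst.
rewrite ext_d_flatE YE0 YE1 !mc.
have := killing_skew Y1 Y0 Ux; have := inner_sym mG Y1 (A Y0 x) Ux.
have := f_equal (inner G x (Z x)) (christoffelC mG Y0 Y1 Ux).
by lra_inner.
Qed.

(** Differentiate 2 <A Y0, Y1>: the correction in the second slot cancels the term <A Y0, nabla_X
    Y1>, and the one in the first slot completes nabla^2. *)
Lemma nabla_form_dual X x (Y : 'I_2 -> E) Y0 Y1 : U x ->
  Y ord0 = Y0 -> Y (lift ord0 ord0) = Y1 ->
  nabla_form G X (ext_d (flat G Z)) x Y =
  2 * inner G x (nabla2 G (cst X) (cst Y0) Z x) Y1.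
Proof.
move=> Ux YE0 YE1; rewrite /nabla_form big_ord_recl big_ord1 YE0 YE1.
have -> : 'D_X (fun y => ext_d (flat G Z) y Y) x =
          'D_X (fun y => 2 * inner G y (A Y0 y) (cst Y1 y)) x.
  by apply: near_eq_derive; apply: filterS (nearU Ux) => y Uy; exact: ext_d_dual.
have -> : ext_d (flat G Z) x [eta Y with ord0 |-> christoffel G x X Y0] +
    ext_d (flat G Z) x [eta Y with lift ord0 ord0 |-> christoffel G x X Y1] =
    2 * inner G x (A (christoffel G x X Y0) x) Y1 +
    2 * inner G x (A Y0 x) (christoffel G x X Y1).
  by congr (_ + _); exact: ext_d_dual.
rewrite deriveZ; last first.
  by apply: derivable_inner => //; [exact: dG|exact: derivable_nabla].
rewrite (metric_compatible mG) //; last exact: derivable_nabla.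
rewrite nabla_cst_cst nabla2E innerBl -[_ *: _]/(_ * _) -[cst Y1 x]/Y1.
by ring_inner.
Qed.

(** Six second derivatives of functions <Z, w> cancel in pairs by the Schwarz theorem. *)
Lemma ext_d_dual_closed x (Y : 'I_3 -> E) : U x ->
  ext_d (ext_d (flat G Z)) x Y = 0.
Proof.
move=> Ux; pose h w y := inner G y (Z y) w.
have Ch w : C2_on U (h w) by exact: C2_on_flat.
have dDh a b w : derivable ('D_a (h w)) x b.
  by apply: diff_derivable; exact: (Ch w x Ux).2.
have E1 a (Y' : 'I_2 -> E) : 'D_a (fun y => ext_d (flat G Z) y Y') x =
    'D_a ('D_(Y' ord0) (h (Y' (lift ord0 ord0)))) x
    - 'D_a ('D_(Y' (lift ord0 ord0)) (h (Y' ord0))) x.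
  rewrite -deriveB //; congr ('D_a _ x); apply/funext => y.
  exact: ext_d_flatE.
have Dsym a b w : 'D_a ('D_b (h w)) x = 'D_b ('D_a (h w)) x.
  exact: (C2_on_schwarz _ _ oU (Ch w)).
rewrite [LHS]/ext_d 2!big_ord_recl big_ord1 !E1.
rewrite (_ : lift (lift ord0 ord0) ord0 = ord0); last exact: val_inj.
rewrite (_ : lift (lift ord0 ord0) (lift ord0 ord0) =
  lift ord0 (lift ord0 ord0)); last exact: val_inj.
rewrite (_ : lift (lift ord0 (lift ord0 ord0)) ord0 = ord0); last exact: val_inj.
rewrite (_ : lift (lift ord0 (lift ord0 ord0)) (lift ord0 ord0) =
  lift ord0 ord0); last exact: val_inj.
move: (Y ord0) (Y (lift ord0 ord0)) (Y (lift ord0 (lift ord0 ord0))) => a b c.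
have := (Dsym b a c, Dsym c a b, Dsym c b a) => /= -[[]].
repeat match goal with
  |- context [derive ?f ?p ?v] => generalize (derive f p v); intro end.
by move=> -> -> ->; rewrite /bump /= expr0 expr1 sqrrN expr1n; ring.
Qed.

(** * The twistor equation for d xi *)

Hypothesis twistorZ : forall x (X : E) (Y : 'I_2 -> E), U x ->
  nabla_form G X (ext_d (flat G Z)) x Y =
    3%:R^-1 * Defs.interior X (ext_d (ext_d (flat G Z))) x Y
    - (n%:R - 1%:R)^-1 * wedge G X (codiff G (ext_d (flat G Z))) x Y.

Lemma twistor_nabla2 x : U x -> exists alpha, forall u v,
  nabla2 G (cst u) (cst v) Z x = inner G x alpha v *: u - inner G x u v *: alpha.
Proof.
(* The vector dual to the codifferential of d xi; its factor 2 is that of [nabla_form_dual]. *)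
move=> Ux; pose delta : E := - \sum_a \sum_b
  (invmx (G x) a b * 2) *: nabla2 G (cst (evec R a)) (cst (evec R b)) Z x.
have codiffE (Y : 'I_1 -> E) w : Y ord0 = w ->
    codiff G (ext_d (flat G Z)) x Y = inner G x delta w.
  move=> Yw; rewrite /codiff /delta innerNl inner_suml; congr (- _).
  apply: eq_bigr => a _; rewrite inner_suml; apply: eq_bigr => b _.
  rewrite innerZl -mulrA; congr (_ * _); apply: nabla_form_dual => //.
    by rewrite /vcons unlift_none.
  by rewrite /vcons liftK.
(* The half offsets the factor 2 of [nabla_form_dual]. For n = 1 the inverse of 0 is 0, here as in
   the twistor equation. *)
exists (((n%:R - 1%:R)^-1 / 2) *: delta) => u v; apply: (inner_inj mG Ux) => w.
pose Y (k : 'I_2) := if k == ord0 then v else w.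
have := twistorZ u Y Ux; rewrite (nabla_form_dual u Ux (Y0 := v) (Y1 := w)) //.
rewrite [Defs.interior _ _]/Defs.interior ext_d_dual_closed // mulr0 sub0r.
rewrite /wedge big_ord_recl big_ord1 (codiffE _ w) // (codiffE _ v) //.
move: (nabla2 _ _ _ _ _) (_ - _)^-1 => N k.
rewrite innerBl !innerZl -[Y ord0]/v -[Y (lift _ _)]/w /bump /= expr0 expr1.
generalize_inner; intros e; apply: (@mulfI _ 2); first by rewrite pnatr_eq0.
by rewrite e; field.
Qed.

(** * Constant length and the pointwise Sasakian identity *)

Variable L : R.
Hypothesis lenZ : forall x, U x -> inner G x (Z x) (Z x) = L.

Lemma inner_nabla_self x u : U x -> inner G x (A u x) (Z x) = 0.
Proof.
move=> Ux; have : 'D_u (fun y => inner G y (Z y) (Z y)) x = 'D_u (cst L) x.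
  by apply: near_eq_derive; apply: filterS (nearU Ux) => y Uy; exact: lenZ.
rewrite derive_cst (metric_compatible mG) //; [|exact: dZ..].
by have := inner_sym mG (Z x) (A u x) Ux; lra_inner.
Qed.

(** Differentiate <A v, Z> = 0 along u; the Christoffel correction in nabla^2 is itself a value of
    A, hence orthogonal to Z. *)
Lemma inner_nabla2_self x u v : U x ->
  inner G x (nabla2 G (cst u) (cst v) Z x) (Z x) = - inner G x (A v x) (A u x).
Proof.
move=> Ux; have : 'D_u (fun y => inner G y (A v y) (Z y)) x = 'D_u (cst 0) x.
  by apply: near_eq_derive; apply: filterS (nearU Ux) => y Uy;
    exact: inner_nabla_self.
rewrite derive_cst (metric_compatible mG) //; [|exact: derivable_nabla|exact: dZ].
rewrite nabla2E innerBl; have := inner_nabla_self (christoffel G x u v) Ux.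
by lra_inner.
Qed.

(** Settles fields of length zero: [inner_nabla2_self] with v = u gives <A u, A u> = 0. *)
Lemma nabla_eq0 x u : U x -> Z x = 0 -> A u x = 0.
Proof.
move=> Ux Z0; apply: (inner_eq0 mG Ux).
have := inner_nabla2_self u u Ux; rewrite Z0 inner0r.
by lra_inner.
Qed.

(** When Z does not vanish, A u is both a multiple of Z and orthogonal to it. *)
Lemma nabla_eq0_le1 x u : (n <= 1)%N -> L != 0 -> U x -> A u x = 0.
Proof.
move=> n1 L0 Ux; have [Z0|] := eqVneq (Z x) 0; first exact: nabla_eq0.
case/rV0Pn => i Zi0; pose t := A u x 0 i / Z x 0 i.
have AE : A u x = t *: Z x.
  apply/rowP => j; suff -> : j = i by rewrite [RHS]mxE divfK.
  apply: val_inj => /=; have := ltn_ord i; have := ltn_ord j; clear -n1.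
  move: (nat_of_ord i) (nat_of_ord j) => a b.
  by case: n n1 => [|[]] //; case: a b => [|?] [|?].
have := inner_nabla_self u Ux; rewrite AE innerZl lenZ // => /eqP.
by rewrite mulf_eq0 (negPf L0) orbF => /eqP ->; rewrite scale0r.
Qed.

(** L times this quantity is the squared length of L u - <u, Z> Z. *)
Lemma cauchy_schwarz_length x u : 0 < L -> U x ->
  0 <= L * inner G x u u - inner G x u (Z x) * inner G x u (Z x).
Proof.
move=> L0 Ux; rewrite -(pmulr_rge0 _ L0).
have := inner_ge0 mG (L *: u - inner G x u (Z x) *: Z x) Ux.
rewrite !(innerBl, innerBr, innerZl, innerZr) lenZ // (inner_sym mG (Z x) u Ux).
by generalize_inner; intros; nra.
Qed.

(** The Sasakian identity with a factor that may still vary from point to point. *)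
Definition sasakian_at x (k : R) : Prop := forall u v,
  nabla2 G (cst u) (cst v) Z x =
  k *: (inner G x (Z x) v *: u - inner G x u v *: Z x).

Lemma sasakian_at_inner x k : U x -> sasakian_at x k -> forall u v,
  inner G x (A u x) (A v x) =
  k * (L * inner G x u v - inner G x u (Z x) * inner G x v (Z x)).
Proof.
move=> Ux sk u v; have := inner_nabla2_self v u Ux.
rewrite sk innerZl innerBl !innerZl lenZ //.
rewrite (inner_sym mG (Z x) u Ux) (inner_sym mG v u Ux).
by lra_inner.
Qed.

Lemma sasakian_at_nabla_eq0 x k u : 0 < L -> k <= 0 -> U x ->
  sasakian_at x k -> A u x = 0.
Proof.
move=> L0 k0 Ux sk; apply/(inner_eq0 mG Ux)/le_anti.
rewrite (inner_ge0 mG) // andbT (sasakian_at_inner Ux sk).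
by rewrite mulr_le0_ge0 // cauchy_schwarz_length.
Qed.

(** Comparing the Z-components of nabla^2_{Z,v} Z and nabla^2_{v,Z} Z, equal by [inner_nabla2_self],
    gives L <alpha, v> = <alpha, Z> <Z, v>. *)
Lemma sasakian_at_ex x : U x -> L != 0 -> exists k, sasakian_at x k.
Proof.
move=> Ux L0; have [al alE] := twistor_nabla2 Ux.
have alZ v : inner G x al v * L = inner G x al (Z x) * inner G x (Z x) v.
  have := inner_nabla2_self (Z x) v Ux; have := inner_nabla2_self v (Z x) Ux.
  rewrite !alE !innerBl !innerZl lenZ //.
  have := inner_sym mG (A v x) (A (Z x) x) Ux; have := inner_sym mG v (Z x) Ux.
  by lra_inner.
have {}alZ : al = (inner G x al (Z x) / L) *: Z x.
  apply: (inner_inj mG Ux) => v; rewrite innerZl; apply: (mulIf L0).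
  by rewrite alZ mulrAC divfK.
exists (inner G x al (Z x) / L) => u v; rewrite alE.
move: (_ / L) alZ => k ->.
by rewrite innerZl scalerBr !scalerA (mulrC k (inner G x u v)).
Qed.

(** With P = <A w, A w> and N = L <w, w> - <Z, w>^2 for a constant w, one has P = f N. A direct
    computation gives DP = f DN, hence N Df = 0. *)
Lemma sasakian_locally_constant (f : E -> R) x : U x ->
  (forall y, U y -> sasakian_at y (f y)) ->
  (forall y, U y -> exists w,
    L * inner G y w w - inner G y w (Z y) ^+ 2 != 0) ->
  \forall y \near x, f y = f x.
Proof.
move=> Ux sf nw; suff H (y z : E) : U y -> derivable f y z /\ 'D_z f y = 0.
  by apply: (locally_constant oU Ux) => y z /(H y z)[].
move=> Uy; have [w Nw] := nw y Uy.
pose P t := inner G t (A w t) (A w t).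
pose a t := inner G t w w; pose b t := inner G t (Z t) w.
pose N t := L * a t - b t * b t.
have PN t : U t -> P t = f t * N t.
  move=> Ut; rewrite /P (sasakian_at_inner Ut (sf t Ut)) /N /a /b.
  by rewrite (inner_sym mG (Z t) w Ut).
have N0 : N y != 0 by rewrite /N /a /b (inner_sym mG (Z y) w Uy) -expr2.
have Ca : C2_on U a by apply: C2_on_inner => i; exact: C2_on_cst.
have Cb : C2_on U b := C2_on_flat w.
have dfN : differentiable N y.
  by apply: differentiableB; apply: differentiableM => //;
     [exact: (Ca y Uy).1|exact: (Cb y Uy).1..].
have dA : derivable (A w) y z by exact: derivable_nabla.
have da : derivable a y z by apply: diff_derivable; exact: (Ca y Uy).1.
have db : derivable b y z by apply: diff_derivable; exact: (Cb y Uy).1.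
have dN : derivable N y z := diff_derivable dfN.
have dP : derivable P y z by apply: derivable_inner => //; exact: dG.
(* [f] is only given pointwise; it is differentiable because it equals P / N near y. *)
have df : derivable f y z.
  apply: (@near_eq_derivable _ _ _ (fun t => P t * (N t)^-1)).
    have Nn : \forall t \near y, N t != 0.
      exact: (cvgr_neq0 _ (differentiable_continuous dfN) N0).
    apply: filterS2 (nearU Uy) Nn => t Ut Nt.
    by rewrite PN // mulfK.
  exact: (derivableM dP (derivableV N0 dN)).
split=> //.
have PE : 'D_z P y = 'D_z (fun t => f t * N t) y.
  by apply: near_eq_derive; apply: filterS (nearU Uy) => t; exact: PN.
have NE : 'D_z N y = L * 'D_z a y - 2 * b y * 'D_z b y.
  exact: derive_quadratic.
have dw : derivable (cst w : E -> E) y z by exact: derivable_cst.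
have aE : 'D_z a y = 2 * inner G y (christoffel G y z w) w.
  transitivity (inner G y (nabla G (cst z) (cst w) y) w
                + inner G y w (nabla G (cst z) (cst w) y)).
    exact: (metric_compatible mG Uy dw dw).
  rewrite nabla_cst_cst; have := inner_sym mG w (christoffel G y z w) Uy.
  by lra_inner.
have bE : 'D_z b y = inner G y (A z y) w + inner G y (Z y) (christoffel G y z w).
  have := metric_compatible mG Uy (dZ Uy : derivable Z y z) dw.
  by rewrite nabla_cst_cst.
have PE' : 'D_z P y = 2 * (inner G y (nabla2 G (cst z) (cst w) Z y) (A w y)
     + inner G y (A (christoffel G y z w) y) (A w y)).
  transitivity (inner G y (nabla G (cst z) (A w) y) (A w y)
                + inner G y (A w y) (nabla G (cst z) (A w) y)).
    exact: (metric_compatible mG Uy dA dA).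
  rewrite nabla2E innerBl.
  have := inner_sym mG (A w y) (nabla G (cst z) (A w) y) Uy.
  by lra_inner.
move: PE; rewrite (deriveM df dN) PE' -![_ *: _]/(_ * _) NE aE bE.
(* The component along Z drops out as A w is orthogonal to Z, and skewness turns <z, A w> into - <A
   z, w>. *)
have e1 : inner G y (nabla2 G (cst z) (cst w) Z y) (A w y) =
    - (f y * (b y * inner G y (A z y) w)).
  rewrite (sf y Uy z w) innerZl innerBl !innerZl /b.
  have -> : inner G y (Z y) (A w y) = 0.
    by rewrite (inner_sym mG) // inner_nabla_self.
  rewrite (inner_nablaC z w Uy) (inner_sym mG w (A z y) Uy).
  by ring_inner.
have e2 : inner G y (A (christoffel G y z w) y) (A w y) =
    f y * (L * inner G y (christoffel G y z w) w
           - inner G y (Z y) (christoffel G y z w) * b y).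
  rewrite (sasakian_at_inner Uy (sf y Uy)) (inner_sym mG _ (Z y) Uy).
  by rewrite (inner_sym mG w (Z y) Uy).
move=> e; apply: (mulfI N0); rewrite mulr0; move: e1 e2 e.
move: (f y) (b y) ('D_z f y) (N y) => fy bt Df Ny.
by lra_inner.
Qed.

(** Any nonzero w orthogonal to Z will do. It exists because the orthogonality condition is the
    kernel of a single column, of rank at most 1 < n. *)
Lemma exists_norm_gap x : (1 < n)%N -> 0 < L -> U x ->
  exists w, L * inner G x w w - inner G x w (Z x) ^+ 2 != 0.
Proof.
move=> n1 L0 Ux; pose c := G x *m (Z x)^T.
have : kermx c != 0.
  rewrite -mxrank_eq0 mxrank_ker subn_eq0 -ltnNge; apply: leq_ltn_trans n1.
  exact: rank_leq_col.
case/rowV0Pn => w /sub_kermxP wc w0; exists w.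
have -> : inner G x w (Z x) = 0 by rewrite /inner -mulmxA -/c wc mxE.
by rewrite expr0n subr0 mulf_neq0 ?gt_eqF // (metric_pos mG).
Qed.

End Killing.

(** * Change of coordinates and globalization *)

Lemma inner_row_sum (R : realType) (n : nat) (G : 'rV[R]_n -> 'M[R]_n)
    (x u w : 'rV[R]_n) :
  inner G x u w = \sum_b w 0 b * inner G x u (evec R b).
Proof.
rewrite {1}(row_sum_delta w); elim: (index_enum _) => [|b r IH].
  by rewrite !big_nil inner0r.
by rewrite !big_cons innerDr innerZr IH.
Qed.

Section ChangeOfCoordinates.
Variables (R : realType) (n : nat).
Local Notation E := 'rV[R]_n.
Variables (O V : set E) (phi : E -> E).
Hypotheses (oO : open O) (phi_smooth : smooth_on O phi).
Hypothesis phiV : forall y, O y -> V (phi y).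
Variables (G1 G2 : E -> 'M[R]_n) (Z1 Z2 : E -> E).
Hypothesis CZ2 : forall w, C2_on V (fun z => inner G2 z (Z2 z) w).
Hypothesis phi_flat : forall y v, O y ->
  inner G1 y (Z1 y) v = inner G2 (phi y) (Z2 (phi y)) ('D_v phi y).

(* The second derivatives of [phi] cancel because they are symmetric. *)
Lemma ext_d_flat_natural x (Y : 'I_2 -> E) : O x ->
  ext_d (flat G1 Z1) x Y = ext_d (flat G2 Z2) (phi x) (fun k => 'D_(Y k) phi x).
Proof.
move=> Ox; pose h b z := inner G2 z (Z2 z) (evec R b).
have Ch b : C2_on V (h b) by exact: CZ2.
have dphi : differentiable phi x by exact: (phi_smooth [::]).
have dDphi v u : derivable ('D_v phi) x u.
  by apply: diff_derivable; exact: (phi_smooth [:: v]).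
have dh b : differentiable (h b) (phi x) by exact: (Ch b _ (phiV Ox)).1.
have dhphi b u : derivable (h b \o phi) x u.
  by apply: diff_derivable; exact: differentiable_comp.
(* The contribution of the second derivatives of [phi], written in components so that only scalar
   product and chain rules are needed. *)
pose S u v := \sum_b ('D_u (fun y => 'D_v phi y 0 b) x * h b (phi x)).
have D1 u v : 'D_u (fun y => inner G1 y (Z1 y) v) x =
    S u v + 'D_('D_u phi x) (fun z => inner G2 z (Z2 z) ('D_v phi x)) (phi x).
  have -> : 'D_u (fun y => inner G1 y (Z1 y) v) x =
      'D_u (fun y => \sum_b ('D_v phi y 0 b * (h b \o phi) y)) x.
    apply: near_eq_derive; have : nbhs x O by exact: open_nbhs_nbhs.
    by apply: filterS => y Oy; rewrite phi_flat // inner_row_sum.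
  rewrite derive_bigsum; last first.
    by move=> b; apply: derivableM => //; exact: derivable_entry.
  have -> : (fun z => inner G2 z (Z2 z) ('D_v phi x)) =
      (fun z => \sum_b ('D_v phi x 0 b * h b z)).
    by apply/funext => z; rewrite inner_row_sum.
  rewrite derive_bigsum; last first.
    by move=> b; apply: derivableM; [exact: derivable_cst|exact: diff_derivable].
  rewrite -big_split; apply: eq_bigr => b _.
  have de : derivable (fun y => 'D_v phi y 0 b) x u by exact: derivable_entry.
  rewrite (deriveM de (dhphi b u)) derive_comp //.
  rewrite (deriveM (f := cst _) (derivable_cst _ _ _) (diff_derivable (dh b))).
  rewrite derive_cst scaler0 addr0 addrC.
  by congr (_ + _); rewrite -[_ *: _]/(_ * _) mulrC.
have Dsym u v b : 'D_u (fun y => 'D_v phi y 0 b) x =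
    'D_v (fun y => 'D_u phi y 0 b) x.
  have Cb : C2_on O (fun y => phi y 0 b) by exact: C2_on_entry.
  have E1 w : \forall y \near x, 'D_w phi y 0 b = 'D_w (fun y => phi y 0 b) y.
    have : nbhs x O by exact: open_nbhs_nbhs.
    apply: filterS => y Oy; rewrite derive_entry //.
    by apply: diff_derivable; exact: (phi_smooth [::]).
  transitivity ('D_u ('D_v (fun y => phi y 0 b)) x); first exact: near_eq_derive.
  rewrite (C2_on_schwarz _ _ oO Cb) //; symmetry; exact: near_eq_derive.
have SC : S (Y ord0) (Y (lift ord0 ord0)) = S (Y (lift ord0 ord0)) (Y ord0).
  rewrite /S; apply: eq_bigr => b _.
  exact: (f_equal (fun t => t * h b (phi x)) (Dsym _ _ b)).
by rewrite !ext_d_flatE !D1 SC [X in X - _]addrC addrKA.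
Qed.

End ChangeOfCoordinates.

(** An injective Jacobian is square, hence invertible. *)
Lemma derivative_surjective (R : realType) (n : nat) (f : 'rV[R]_n -> 'rV[R]_n) x :
  differentiable f x -> (forall u, 'D_u f x = 0 -> u = 0) ->
  forall w, exists u, 'D_u f x = w.
Proof.
move=> df f0 w.
have ju : jacobian f x \in unitmx.
  rewrite -row_free_unit -kermx_eq0; apply/eqP/row_matrixP => i.
  rewrite row0; apply: f0.
  by rewrite deriveEjacobian // -row_mul mulmx_ker row0.
by exists (w *m invmx (jacobian f x)); rewrite deriveEjacobian // mulmxKV.
Qed.

Section Manifold.
Variables (R : realType) (n : nat) (M : manifold R n).
Variable g : riemannian_metric M.
Local Notation E := 'rV[R]_n.

Lemma metric_on_cod (i : chart M) : metric_on (cod i) (g i).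
Proof.
split; [exact: cod_open|exact: gram_smooth|exact: gram_sym|].
by move=> x u; exact: gram_pos.
Qed.

(** It is the preimage of [dom j] under [param i], which is continuous on the open set [cod i]. *)
Lemma overlap_open (i j : chart M) : open (overlap i j).
Proof.
have -> : overlap i j = cod i `&` param i @^-1` dom j.
  apply/seteqP; split=> [x [m [mi mj] <-]|x [[m mi <-]] /=].
    by split; [exists m|rewrite /= coordK].
  by rewrite coordK // => mj; exists m.
have ci : {in cod i, continuous (param i)}.
  by rewrite -continuous_open_subspace; [exact: param_continuous|exact: cod_open].
have [h _] := @continuous_inP _ _ (cod i) (param i) (@cod_open _ _ M i).
exact: h ci _ (@dom_open _ _ M j).
Qed.

Lemma overlap_cod (i j : chart M) x : overlap i j x ->
  cod i x /\ cod j (transition i j x).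
Proof.
move=> [m [mi mj] <-]; split; first by exists m.
by exists m => //; rewrite /transition /= coordK.
Qed.

Lemma transition_coord (i j : chart M) (m : M) : dom i m ->
  transition i j (Defs.coord i m) = Defs.coord j m.
Proof. by move=> mi; rewrite /transition /= coordK. Qed.

(** The differential preserves the metric, so it is injective. *)
Lemma transition_derivative_surjective (i j : chart M) x w : overlap i j x ->
  exists u, 'D_u (transition i j) x = w.
Proof.
move=> Ox; have [Ux Vx] := overlap_cod Ox.
apply: derivative_surjective; first exact: (@transition_smooth _ _ M i j [::]).
move=> u Du; apply: (inner_eq0 (metric_on_cod i) Ux).
by rewrite (gram_transition g u u Ox) Du inner0l.
Qed.

Variable xi : vector_field M.
Hypothesis hkilling : killing g xi.

Let xi_smooth (i : chart M) : smooth_on (cod i) (xi i).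
Proof. exact: vcomp_smooth. Qed.

Let xi_killing (i : chart M) x u v : cod i x -> lie_metric (g i) (xi i) x u v = 0.
Proof. by move=> Ux; exact: hkilling. Qed.

(** Tested against images of tangent vectors, twice each side is a value of d xi, which is natural.
    No transformation law for Christoffel symbols is involved. *)
Lemma nabla_transition (i j : chart M) x (u : E) : overlap i j x ->
  nabla (g j) (cst ('D_u (transition i j) x)) (xi j) (transition i j x) =
  'D_(nabla (g i) (cst u) (xi i) x) (transition i j) x.
Proof.
move=> Ox; have [Ux Vx] := overlap_cod Ox.
apply: (inner_inj (metric_on_cod j) Vx) => w.
have [v <-] : exists v : E, 'D_v (transition i j) x = w.
  exact: transition_derivative_surjective.
rewrite -(gram_transition g _ _ Ox).
apply: (@mulfI _ 2); first by rewrite pnatr_eq0.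
pose Y (k : 'I_2) := if k == ord0 then u else v.
transitivity (ext_d (flat (g j) (xi j)) (transition i j x)
    (fun k => 'D_(Y k) (transition i j) x)).
  symmetry.
  exact: (ext_d_dual (metric_on_cod j) (@xi_smooth j) (@xi_killing j) Vx).
transitivity (ext_d (flat (g i) (xi i)) x Y); last first.
  exact: (ext_d_dual (metric_on_cod i) (@xi_smooth i) (@xi_killing i) Ux).
symmetry.
apply: (@ext_d_flat_natural _ _ (overlap i j) (cod j)) => //.
- exact: overlap_open.
- exact: transition_smooth.
- by move=> y /overlap_cod[].
- exact: (C2_on_flat (metric_on_cod j) (@xi_smooth j)).
- move=> y z Oy; rewrite (gram_transition g _ _ Oy).
  by rewrite (vcomp_transition xi Oy).
Qed.

Hypothesis htwistor : twistor_form g (d_dual g xi).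
Variable c : R.
Hypothesis hlength : forall i x, cod i x ->
  Num.sqrt (inner (g i) x (xi i x) (xi i x)) = c.

Let xi_length (i : chart M) x : cod i x -> inner (g i) x (xi i x) (xi i x) = c ^+ 2.
Proof.
move=> Ux; rewrite -(hlength Ux) sqr_sqrtr //.
exact: (inner_ge0 (metric_on_cod i)).
Qed.

Let xi_twistor (i : chart M) x (X : E) (Y : 'I_2 -> E) : cod i x ->
  nabla_form (g i) X (ext_d (flat (g i) (xi i))) x Y =
    3%:R^-1 * Defs.interior X (ext_d (ext_d (flat (g i) (xi i)))) x Y
    - (n%:R - 1%:R)^-1
      * wedge (g i) X (codiff (g i) (ext_d (flat (g i) (xi i)))) x Y.
Proof. by move=> Ux; exact: htwistor. Qed.

(** The second chart has some factor k' at the image point. In [sasakian_at_inner] everything but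
    the factor is invariant, and a w with nonzero gap forces k = k'. *)
Lemma sasakian_at_transition (i j : chart M) x k : (1 < n)%N -> c != 0 ->
  overlap i j x -> sasakian_at (g i) (xi i) x k ->
  sasakian_at (g j) (xi j) (transition i j x) k.
Proof.
move=> n1 c0 Ox sk; have [Ux Vx] := overlap_cod Ox.
have L0 : 0 < c ^+ 2 by rewrite exprn_even_gt0.
have [k' sk'] := sasakian_at_ex (metric_on_cod j) (@xi_smooth j) (@xi_killing j)
  (@xi_twistor j) (@xi_length j) Vx (lt0r_neq0 L0).
suff -> : k = k' by [].
have [w Nw] := exists_norm_gap (metric_on_cod i) (xi i) n1 L0 Ux.
apply: (mulIf Nw); rewrite expr2.
rewrite -(sasakian_at_inner (metric_on_cod i) (@xi_smooth i) (@xi_length i) Ux sk).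
rewrite !(gram_transition g _ _ Ox) -nabla_transition // -(vcomp_transition xi Ox).
exact: (sasakian_at_inner (metric_on_cod j) (@xi_smooth j) (@xi_length j) Vx sk').
Qed.

(** The level sets of the pointwise factor are open and partition M, so connectedness leaves only
    one. *)
Lemma sasakian_at_global : connected [set: M] -> (1 < n)%N -> c != 0 ->
  M -> exists k, forall i x, cod i x -> sasakian_at (g i) (xi i) x k.
Proof.
move=> hM n1 c0 m0; have L0 : 0 < c ^+ 2 by rewrite exprn_even_gt0.
have ex (i : chart M) x : cod i x -> exists k, sasakian_at (g i) (xi i) x k.
  move=> Ux; exact: (sasakian_at_ex (metric_on_cod i) (@xi_smooth i)
    (@xi_killing i) (@xi_twistor i) (@xi_length i) Ux (lt0r_neq0 L0)).
have gap (i : chart M) x (Ux : cod i x) :=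
  exists_norm_gap (metric_on_cod i) (xi i) n1 L0 Ux.
have uniq (i : chart M) x k k' : cod i x ->
    sasakian_at (g i) (xi i) x k -> sasakian_at (g i) (xi i) x k' -> k = k'.
  move=> Ux sk sk'; have [w Nw] := gap i x Ux.
  apply: (mulIf Nw); rewrite expr2.
  by rewrite -!(sasakian_at_inner (metric_on_cod i) (@xi_smooth i)
    (@xi_length i) Ux).
pose S k : set M :=
  [set m | exists2 i, dom i m & sasakian_at (g i) (xi i) (Defs.coord i m) k].
have S_chart k m i : dom i m -> S k m -> sasakian_at (g i) (xi i) (Defs.coord i m) k.
  move=> mi [j mj /(sasakian_at_transition n1 c0 (i := j) (j := i))].
  by rewrite transition_coord //; apply; exists m.
have S_open k : open (S k).
  rewrite openE => m [i mi sk].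
  have Ux : cod i (Defs.coord i m) by exists m.
  (* The factor as a function on the chart; the default 0 is never taken on [cod i], where a factor
     exists. *)
  pose f x := xget 0 [set k | sasakian_at (g i) (xi i) x k].
  have sf x : cod i x -> sasakian_at (g i) (xi i) x (f x).
    by move=> /ex[k' sk']; rewrite /f; case: xgetP => [? _ //|/(_ k')].
  have fk : f (Defs.coord i m) = k by apply: uniq sk => //; exact: sf.
  have := sasakian_locally_constant (metric_on_cod i) (@xi_smooth i)
    (@xi_killing i) (@xi_length i) Ux sf (gap i).
  rewrite fk => near_f.
  have ci : {in dom i, continuous (Defs.coord i)}.
    by rewrite -continuous_open_subspace; [exact: Defs.coord_continuous|exact: dom_open].
  have cm : {for m, continuous (Defs.coord i)} by apply: ci; rewrite inE.
  have nd : nbhs m (dom i).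
    by apply: open_nbhs_nbhs; split => //; exact: dom_open.
  have := cm _ near_f; rewrite nbhs_simpl /= => nf.
  apply: filterS2 nd nf => p pi /= fp; exists i => //.
  by rewrite -fp; apply: sf; exists p.
have S_total m : exists k, S k m.
  have [i mi] := @dom_cover _ _ M m.
  by have [|k sk] := ex i (Defs.coord i m); [exists m|exists k; exists i].
have S_uniq m k k' : S k m -> S k' m -> k = k'.
  have [i mi] := @dom_cover _ _ M m.
  move=> /(S_chart _ _ _ mi) sk /(S_chart _ _ _ mi) sk'.
  by apply: uniq sk sk'; exists m.
have [k0 S0] := S_total m0.
have SE : S k0 = [set: M].
  apply: hM; first by exists m0.
    by exists (S k0) => //; rewrite setTI.
  exists (S k0); last by rewrite setTI.
  rewrite -[S k0]setCK; apply: open_closedC.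
  (* [S k0] is closed, since the other level sets cover its complement. *)
  have -> : ~` S k0 = \bigcup_(k in [set k | k != k0]) S k.
    apply/seteqP; split=> [m nS|m [k /= kk0 Sk] Sk0].
      have [k Sk] := S_total m; exists k => //=.
      by apply: contra_notN nS => /eqP <-.
    by move/eqP: kk0; apply; exact: S_uniq Sk Sk0.
  by apply: bigcup_open => k _; exact: S_open.
exists k0 => i x [m mi <-]; apply: S_chart => //.
by rewrite SE.
Qed.

End Manifold.

Theorem proposition2p3 (R : realType) (n : nat) (M : manifold R n)
  (g : riemannian_metric M) (xi : vector_field M)
  (hM : connected [set: M]%classic)
  (hkilling : killing g xi) (hlength : constant_length g xi)
  (htwistor : twistor_form g (d_dual g xi)) :
  parallel g xi \/ sasakian g xi.
Proof.
have [c lc] := hlength.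
have smooth_xi (i : chart M) : smooth_on (cod i) (xi i) by exact: vcomp_smooth.
have len (i : chart M) x : cod i x -> inner (g i) x (xi i x) (xi i x) = c ^+ 2.
  move=> Ux; rewrite -(lc i x Ux) sqr_sqrtr //.
  exact: (inner_ge0 (metric_on_cod g i)).
(* Length zero and dimension at most one are treated apart: the factor k requires c != 0 and its
   uniqueness a vector with nonzero gap. *)
have [c0|c0] := eqVneq c 0.
  left=> i x Ux u.
  apply: (nabla_eq0 (metric_on_cod g i) (smooth_xi i) (@len i)) => //.
  by apply: (inner_eq0 (metric_on_cod g i) Ux); rewrite len // c0 expr0n.
have L0 : 0 < c ^+ 2 by rewrite exprn_even_gt0.
have [n1|n1] := leqP n 1.
  left=> i x Ux u.
  exact: (nabla_eq0_le1 (metric_on_cod g i) (smooth_xi i) (@len i)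
    u n1 (lt0r_neq0 L0)).
(* The global factor needs a base point; on an empty manifold every field is parallel. *)
have [[m0 _]|M0] := pselect (exists m : M, True); last first.
  by left=> i x [m _ _]; case: M0; exists m.
have [k sk] := sasakian_at_global hkilling htwistor lc hM n1 c0 m0.
have [k0|k0] := ltP 0 k; last first.
  left=> i x Ux u.
  exact: (sasakian_at_nabla_eq0 (metric_on_cod g i) (smooth_xi i) (@len i)
    u L0 k0 Ux (sk i x Ux)).
by right; split=> //; exists k => // i x /sk.
Qed.
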